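(* Let $G$ be a honeycomb, 4.8.8 or 4.6.12 lattice on a torus, large enough that every non-contractible cycle has length greater than $8$, and let $e=\{v_1,v_2\}$ be any edge of $G$. Choose the shrink face $S$ among the two faces containing $e$ as one of minimal weight (number of boundary edges). Let $G'$ be the output of the defective-edge procedure applied to $(G,e,S)$, and let $K$ be the weight of $S$. Then $R(G')=(K-2)/2$. Concretely, $R(G')$ takes the following values: - honeycomb lattice: $2$; - 4.8.8 lattice: $1$ if $e$ borders a square, and $3$ if $e$ borders two octagons; - 4.6.12 lattice: $1$ if $e$ borders a square, and $2$ otherwise. Moreover, $R(G')\le R(H)$ for every lattice $H$ satisfying all of the following: - $H$ is a tri-valent, 3-face-colourable multigraph on the same torus; - $H$ has the same vertex set as $G$; - every edge of $H$ joins two vertices that are adjacent in $G$ via an edge other than $e$. Equivalently, for the heavy honeycomb, heavy 4.8.8 and heavy 4.6.12 lattices (each edge subdivided by an auxiliary vertex), this procedure removes a defective auxiliary vertex while removing the minimal number of additional auxiliary vertices.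
   Context: A colour-code lattice is a finite multigraph, in which parallel edges are allowed but loops are not, cellularly embedded in a closed surface. It must be tri-valent and 3-face-colourable. Every edge borders two faces of different colours and is assigned the third colour. The defective-edge procedure takes as input $(G,e,S)$, where $e$ is an edge of colour $D$ and $S$ is a face containing $e$, of colour $A$. Let $B$ be the third colour. 1. The merge faces are the faces of colour $B$ that share an edge with $S$. 2. For each colour-$B$ edge $f$ of $S$, add a parallel edge $f'$ of colour $D$ and a new face $\{f,f'\}$ of colour $A$. 3. Delete $S$. 4. Add a new face of colour $B$ consisting of all new edges $f'$, together with all merge-face edges not on $S$. 5. Delete the merge faces. 6. Delete the edges lying on no face; these are the colour-$D$ edges of $S$. The honeycomb, 4.8.8 and 4.6.12 lattices are the periodic (torus) versions of the uniform planar tilings by regular polygons with vertex configurations 6.6.6, 4.8.8 and 4.6.12, respectively. For a multigraph $H$ on $V(G)$, define $R(H)$ as the number of unordered pairs $\{x,y\}\neq\{v_1,v_2\}$ that are adjacent in $G$ but not adjacent in $H$. This is the number of removed connections in addition to the defective one. *)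

(* Defs.v *)
(* Colour-code lattices encoded as combinatorial maps
   (rotation systems): darts D, vertex map vert : D -> V, edge involution
   alpha, vertex rotation sigma; faces are the orbits of phi = sigma \o alpha. *)
From Stdlib Require Import Relation_Operators.
From mathcomp Require Import all_boot all_order.

Set Implicit Arguments.
Unset Strict Implicit.
Unset Printing Implicit Defensive.

Section Maps.
Variables (D V : finType) (vert : D -> V) (alpha sigma : D -> D).

Definition phi (d : D) : D := sigma (alpha d).

Definition edge (d : D) : {set D} := [set d; alpha d].

Definition faceD (d : D) : {set D} := [set x | fconnect phi d x].

Definition fweight (d : D) : nat := order phi d.

Definition face_colouring (col : D -> 'I_3) : Prop :=
  (forall d, col (phi d) = col d) /\ (forall d, col d != col (alpha d)).

(* colour-code lattice cellularly embedded in the torus: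
   a connected trivalent rotation system without loops, whose vertex set is
   exactly V, with Euler characteristic 0 (V - E + F = 0; rotation systems are
   orientable), and which is 3-face-colourable. *)
Definition is_ccl_torus : Prop :=
  involutive alpha /\
  (forall d, vert (alpha d) != vert d) /\
  injective sigma /\
  (forall d d', fconnect sigma d d' = (vert d == vert d')) /\
  (forall v, exists d, vert d = v) /\
  (forall d, order sigma d = 3) /\
  (forall d d', connect (fun x y => (y == alpha x) || (y == sigma x)) d d') /\
  #|V| + #|[set faceD d | d : D]| = #|[set edge d | d : D]| /\
  (exists col, face_colouring col).

Inductive lattice_kind := Honeycomb | L488 | L4612.

Definition config (k : lattice_kind) : seq nat :=
  match k with
  | Honeycomb => [:: 6; 6; 6]
  | L488 => [:: 4; 8; 8]
  | L4612 => [:: 4; 6; 12]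
  end.

Definition has_config (k : lattice_kind) : Prop :=
  forall d, perm_eq [:: fweight d; fweight (sigma d); fweight (sigma (sigma d))]
                    (config k).

Definition is_walk (s : seq D) : bool :=
  if s is d :: s' then path (fun x y => vert y == vert (alpha x)) d s' else true.

Definition closed_walk (s : seq D) : bool :=
  is_walk s && (if s is d :: _ then vert (alpha (last d s)) == vert d else true).

(* elementary homotopy moves on closed walks: inserting a backtrack, inserting
   a face boundary, rotating the base point *)
Definition hom_step (s t : seq D) : Prop :=
  [/\ closed_walk s, closed_walk t &
   [\/ exists s1 s2 d, s = s1 ++ s2 /\ t = s1 ++ [:: d; alpha d] ++ s2,
       exists s1 s2 d, s = s1 ++ s2 /\ t = s1 ++ traject phi d (order phi d) ++ s2
     | t = rot 1 s]].

Definition contractible (s : seq D) : Prop :=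
  clos_refl_sym_trans (seq D) hom_step s [::].

Definition is_cycle (s : seq D) : bool :=
  [&& closed_walk s, s != [::], uniq (map vert s) & uniq (map edge s)].

Definition adjacent (p : {set V}) : bool :=
  [exists d, [set vert d; vert (alpha d)] == p].

End Maps.

Definition third (a b : 'I_3) : 'I_3 := inord (3 - a - b).

Definition Rcount (V : finType) (adjG adjH : {set V} -> bool) (v1 v2 : V) : nat :=
  #|[set p : {set V} | [&& #|p| == 2, p != [set v1; v2], adjG p & ~~ adjH p]]|.

(* The defective-edge procedure applied to (G, e, S), where e is the edge of
   dart s and S is the face containing s.  A := colour of S,
   B := colour of the other face of e, D := third colour (colour of e).
   Edges of the output are (E, false) for an original edge E and (f, true)
   for the new parallel copy f' of a B-edge f of S.  The result is returned
   as the adjacency predicate of the output multigraph G' (on vertex set V). *)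
Section Procedure.
Variables (D V : finType) (vert : D -> V) (alpha sigma : D -> D) (col : D -> 'I_3) (s : D).

Local Notation phi := (phi alpha sigma).
Local Notation edge := (edge alpha).
Local Notation faceD := (faceD alpha sigma).

Definition face_edges (F : {set D}) : {set {set D}} := [set edge x | x in F].
Definition edge_col (x : D) : 'I_3 := third (col x) (col (alpha x)).

Definition colB : 'I_3 := col (alpha s).
Definition Sface : {set D} := faceD s.
Definition all_faces : {set {set D}} := [set faceD d | d : D].
Definition all_edges : {set {set D}} := [set edge d | d : D].

Definition Bedges : {set {set D}} := [set edge x | x in Sface & edge_col x == colB].

Definition merge_faces : {set {set D}} :=
  [set F in all_faces | [exists y in F, col y == colB] &&
                        [exists E in face_edges Sface, E \in face_edges F]].

Definition EdgeT := ({set D} * bool)%type.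

Definition init_edges : {set EdgeT} :=
  [set (E, false) | E in all_edges] :|: [set (f, true) | f in Bedges].

Definition new_faces : {set {set EdgeT}} :=
  [set [set (E, false) | E in face_edges F]
     | F in all_faces & (F != Sface) && (F \notin merge_faces)]
  :|: [set [set (f, false); (f, true)] | f in Bedges]
  :|: [set [set (f, true) | f in Bedges]
           :|: [set (E, false) | E in \bigcup_(F in merge_faces) face_edges F
                                & E \notin face_edges Sface]].

Definition out_edges : {set EdgeT} :=
  [set x in init_edges | [exists F in new_faces, x \in F]].

Definition ends (x : EdgeT) : {set V} := [set vert d | d in x.1].

Definition adj_out (p : {set V}) : bool := [exists x in out_edges, ends x == p].

End Procedure.

(* Main.v *)
From Stdlib Require Import ZArith.
Require Import Defs.
From mathcomp Require Import all_boot all_order ssrZ zify.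

(** A trivalent 3-face-coloured map is properly 3-edge-coloured, so a walk is
    a word in three letters.  For the weights 6.6.6, 4.8.8 and 4.6.12 the face
    relations are exactly those of the affine Coxeter groups of type A2, C2 and
    G2; letting the letters act on Z^3 by their reflections, a contractible
    closed walk acts trivially.  Hence a short cycle gives a short word acting
    trivially, and finitely many words remain to be inspected: the lattice has
    no parallel edges, no 4-cycle through an edge not bordering a square, and
    4.8.8 has no 6-cycle.

    The edges of S are alternately of the colour of e and of colour B, the
    procedure disconnects exactly the former, and this gives K/2 - 1 removed
    pairs besides e.

    Conversely the edges of H have multiplicities over G which sum to 3 at
    every vertex and vanish at e.  At the end of an edge of multiplicity 0 there
    is a unique edge of multiplicity at least 2, at whose other end there is
    again an edge of multiplicity 0.  Following this alternation from e without
    closing up a short cycle through e produces K/2 edges of multiplicity 0. *)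

Set Implicit Arguments.
Unset Strict Implicit.
Unset Printing Implicit Defensive.

(** * The affine reflection groups *)

Section Reflections.
(* [W] lists the weights of the faces of colours 0, 1, 2.  The colours [i] and [j]
   alternate around the faces of the third colour [3 - i - j]; if these have weight
   [2 m], the pairings of [i] with [j] and of [j] with [i] multiply to
   [4 cos^2 (pi / m)]. *)
Variable W : seq nat.

Definition coroot_pairing (i j : nat) : Z :=
  let w := nth 0 W (3 - i - j) in
  if i < j then if w == 4 then 0%Z else 1%Z
  else if w == 4 then 0%Z else if w == 6 then 1%Z else if w == 8 then 2%Z else 3%Z.

Arguments coroot_pairing : simpl never.

Definition reflection (i : nat) (v : Z * Z * Z) : Z * Z * Z :=
  let: (x, y, z) := v in
  match i with
  | 0 => (- x + coroot_pairing 0 1 * y + coroot_pairing 0 2 * z, y, z)%Z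
  | 1 => (x, - y + coroot_pairing 1 0 * x + coroot_pairing 1 2 * z, z)%Z
  | _ => (x, y, - z + coroot_pairing 2 0 * x + coroot_pairing 2 1 * y)%Z
  end.

Definition act (w : seq nat) (v : Z * Z * Z) :=
  foldl (fun u i => reflection i u) v w.

Lemma act_cat w1 w2 v : act (w1 ++ w2) v = act w2 (act w1 v).
Proof. exact: foldl_cat. Qed.

Lemma reflectionK i : involutive (reflection i).
Proof. by case: i => [|[|i]] [[x y] z] /=; congr (_, _, _); ring. Qed.

(** The two pairings multiply to 0, 1, 2 or 3 for weights 4, 6, 8 or 12, so the product of the
    reflections has order 2, 3, 4 or 6, half the weight. *)
Lemma reflection_braid i j v : i < 3 -> j < 3 -> i != j ->
  nth 0 W (3 - i - j) \in [:: 4; 6; 8; 12] ->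
  iter (nth 0 W (3 - i - j))./2 (fun u => reflection j (reflection i u)) v = v.
Proof.
move=> Hi Hj; rewrite neq_ltn => Hij Hm.
(* The pairings are kept as equations until the weight is known; [subnAC] lets both refer to the
   same weight. *)
have := erefl (coroot_pairing j i); rewrite {2}/coroot_pairing [3 - j - i]subnAC.
have := erefl (coroot_pairing i j); rewrite {2}/coroot_pairing.
case: v Hm => [[x y] z].
case: i j Hi Hj Hij => [|[|[|//]]] [|[|[|//]]] //= _ _ _;
  rewrite !inE => /or4P[] /eqP -> /= e1 e2;
  cbv beta iota delta [iter reflection]; rewrite e1 e2;
  (apply: f_equal2; [apply: f_equal2|]); ring.
Qed.

(** Rotating a word conjugates its action by the first letter, an involution. *)
Lemma act_rot1 w : (forall v, act (rot 1 w) v = v) <-> (forall v, act w v = v).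
Proof.
case: w => [|i w] //; rewrite rot1_cons; split=> H v.
  rewrite /= -[LHS](reflectionK i) -[RHS](reflectionK i); congr (reflection i _).
  by rewrite -[RHS](H (reflection i v)) -cats1 act_cat /=.
by rewrite -cats1 act_cat /= -[v in act w v](reflectionK i) [act w _]H reflectionK.
Qed.

End Reflections.

(** * Inspection of all short words *)

Definition generic_point : Z * Z * Z := (1, 3, 10)%Z.

Fixpoint words (n : nat) : seq (seq nat) :=
  if n is n'.+1 then [seq i :: w | i <- iota 0 3, w <- words n'] else [:: [::]].

Lemma mem_words w : all (fun i => i < 3) w -> w \in words (size w).
Proof.
elim: w => [|i w IH] // /andP[Hi /IH Hw].
by apply: (allpairs_f cons _ Hw); rewrite mem_iota.
Qed.

(** Moving the single point [generic_point] certifies a nontrivial action. Words with cyclically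
    adjacent equal letters are exempt, since they are not read along cycles. *)
Definition moves (W w : seq nat) : bool :=
  cycle (fun i j => i != j) w ==> (act W w generic_point != generic_point).

(** Reduces to a finite computation. All permutations of the configuration occur, because the three
    colours may carry the weights in any order. *)
Lemma all_words (n : nat) (k : lattice_kind) (P : seq nat -> seq nat -> bool) :
  all (fun W => all (P W) (words n)) (permutations (config k)) ->
  forall W w, perm_eq W (config k) -> all (fun i => i < 3) w -> size w = n -> P W w.
Proof.
move=> /allP H W w; rewrite -mem_permutations => /H/allP HW /mem_words Hw sz.
by apply: HW; rewrite -sz.
Qed.

Lemma moves2 k W w : perm_eq W (config k) -> all (fun i => i < 3) w ->
  size w = 2 -> moves W w.
Proof. by apply: all_words; case: k; vm_compute. Qed.

(* The faces bordered by an edge of colour [head 0 w] are those of the other two colours. *)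
Lemma moves4 k W w : perm_eq W (config k) -> all (fun i => i < 3) w -> size w = 4 ->
  all (fun i => (i == head 0 w) || (5 < nth 0 W i)) (iota 0 3) -> moves W w.
Proof.
(* The side condition becomes the premise of a boolean implication, so that [all_words] applies to
   it. *)
move=> HW Hw sz H; apply: (implyP _ H); move: W w HW Hw sz {H}.
by apply: all_words; case: k; vm_compute.
Qed.

(** Specific to 4.8.8: in the other lattices the boundary of a hexagon is a word of length 6 acting
    trivially. *)
Lemma moves6 W w : perm_eq W (config L488) -> all (fun i => i < 3) w -> size w = 6 ->
  moves W w.
Proof. by apply: all_words; vm_compute. Qed.

Lemma uniq_map_inj_in (T1 T2 : eqType) (f : T1 -> T2) (w : seq T1) :
  uniq (map f w) -> {in w &, injective f}.
Proof.
elim: w => // a w IH /= /andP[fa /IH inj] x y; rewrite !inE.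
case/predU1P => [->|xw] /predU1P[->|yw] // e; last exact: inj.
  by rewrite e map_f in fa.
by rewrite -e map_f in fa.
Qed.

(** * Rotation systems and edge colours *)

Section RotationSystem.
Variables (D V : finType) (vert : D -> V) (alpha sigma : D -> D).
Hypothesis HG : is_ccl_torus vert alpha sigma.

Lemma alphaK : involutive alpha. Proof. by case: HG. Qed.

Lemma vert_alpha d : vert (alpha d) != vert d. Proof. by case: HG => _ []. Qed.

Lemma sigma_inj : injective sigma. Proof. by case: HG => _ [_ []]. Qed.

Lemma fconnect_sigma x y : fconnect sigma x y = (vert x == vert y).
Proof. by case: HG => _ [_ [_ []]]. Qed.

Lemma vert_surj v : exists d, vert d = v. Proof. by case: HG => _ [_ [_ [_ []]]]. Qed.

Lemma order_sigma d : order sigma d = 3. Proof. by case: HG => _ [_ [_ [_ [_ []]]]]. Qed.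

Lemma sigma3 d : sigma (sigma (sigma d)) = d.
Proof. by have := iter_order sigma_inj d; rewrite order_sigma. Qed.

Lemma vert_sigma d : vert (sigma d) = vert d.
Proof. by apply/esym/eqP; rewrite -fconnect_sigma fconnect1. Qed.

Lemma same_vertP x y : vert x = vert y -> [\/ y = x, y = sigma x | y = sigma (sigma x)].
Proof.
move/eqP; rewrite -fconnect_sigma fconnect_orbit /orbit order_sigma !inE.
by case/or3P => /eqP ->; [constructor 1|constructor 2|constructor 3].
Qed.

Lemma card_star v : #|[set d | vert d == v]| = 3.
Proof.
have [d <-] := vert_surj v; rewrite -(order_sigma d) /order; apply: eq_card => x.
by rewrite !inE fconnect_sigma eq_sym.
Qed.

Lemma phi_inj : injective (phi alpha sigma).
Proof. by move=> x y /sigma_inj /(inv_inj alphaK). Qed.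

Lemma phi_alpha d : phi alpha sigma (alpha d) = sigma d.
Proof. by rewrite /phi alphaK. Qed.

Lemma fweight_fconnect x y : fconnect (phi alpha sigma) x y ->
  fweight alpha sigma y = fweight alpha sigma x.
Proof.
move=> xy; apply: eq_card => z; rewrite !inE.
by apply/esym/same_connect => //; exact: fconnect_sym phi_inj.
Qed.

Lemma fweight_phi d : fweight alpha sigma (phi alpha sigma d) = fweight alpha sigma d.
Proof. exact/fweight_fconnect/fconnect1. Qed.

Lemma fweight_alpha d : fweight alpha sigma (alpha d) = fweight alpha sigma (sigma d).
Proof. by rewrite -phi_alpha fweight_phi. Qed.

Lemma mem_edge x y : (y \in edge alpha x) = (y == x) || (y == alpha x).
Proof. by rewrite !inE. Qed.

Lemma edge_alpha d : edge alpha (alpha d) = edge alpha d.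
Proof. by apply/setP => x; rewrite !mem_edge alphaK orbC. Qed.

Lemma edge_eqP x y : edge alpha x = edge alpha y -> y = x \/ y = alpha x.
Proof. by move/setP/(_ y); rewrite !mem_edge eqxx => /orP[] /eqP; [left|right]. Qed.

Lemma ends_edge d : [set vert x | x in edge alpha d] = [set vert d; vert (alpha d)].
Proof. by rewrite /edge imsetU1 imset_set1. Qed.

Lemma mem_face x y : (y \in faceD alpha sigma x) = fconnect (phi alpha sigma) x y.
Proof. by rewrite inE. Qed.

Lemma face_eq x y : y \in faceD alpha sigma x -> faceD alpha sigma y = faceD alpha sigma x.
Proof.
rewrite mem_face => xy; apply/setP => z; rewrite !mem_face.
by apply/esym/same_connect => //; exact: fconnect_sym phi_inj.
Qed.

Lemma closed_walk_cycle w :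
  closed_walk vert alpha w = cycle (fun x y => vert y == vert (alpha x)) w.
Proof. by case: w => //= x w; rewrite rcons_path eq_sym. Qed.

Lemma next_closed_walk w x : closed_walk vert alpha w -> x \in w ->
  vert (next w x) = vert (alpha x).
Proof. by rewrite closed_walk_cycle => cw xw; apply/eqP/(next_cycle cw). Qed.

(** If a dart and its reverse both occurred, each would be the successor of the other, forcing
    length 2. *)
Lemma is_cycle_uniq_vert w : 2 < size w -> closed_walk vert alpha w ->
  uniq (map vert w) -> is_cycle vert alpha w.
Proof.
move=> sz cw uv; have uw := map_uniq uv.
rewrite /is_cycle cw uv -size_eq0 -lt0n (ltn_trans _ sz) //= map_inj_in_uniq //.
have inj := uniq_map_inj_in uv.
move=> x y xw yw /edge_eqP[//|y_x].
have nx : next w x = y.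
  by apply: inj => //; rewrite ?mem_next // y_x next_closed_walk.
have ny : next w y = x.
  by apply: inj => //; rewrite ?mem_next // -[x]alphaK -y_x next_closed_walk.
have [i w' def_w] := rot_to xw.
move: nx ny; rewrite -[next w x](next_rot i uw) -[next w y](next_rot i uw).
move: uw sz; rewrite -(rot_uniq i) -(size_rot i) def_w.
case: w' {def_w} => [|b [|c w']] //= /andP[xnot _] _; rewrite eqxx => <-.
case: eqP => [e|_]; rewrite ?eqxx => e'; move: xnot; first by rewrite e inE eqxx.
by rewrite e' !inE eqxx orbT.
Qed.
End RotationSystem.

Section Colouring.
Variables (D V : finType) (vert : D -> V) (alpha sigma : D -> D) (col : D -> 'I_3).
Hypotheses (HG : is_ccl_torus vert alpha sigma) (Hcol : face_colouring alpha sigma col).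

Local Notation phi := (phi alpha sigma).

Definition ecol (d : D) : nat := 3 - col d - col (alpha d).

Lemma col_phi d : col (phi d) = col d. Proof. by case: Hcol. Qed.

Lemma col_alpha d : col (alpha d) = col (sigma d).
Proof. by rewrite -(phi_alpha HG) col_phi. Qed.

Lemma col_face x y : fconnect phi x y -> col y = col x.
Proof.
move=> /iter_findex <-; elim: (findex _ _ _) => //= n IH.
by rewrite col_phi.
Qed.

Lemma neq_col_alpha d : (col d : nat) != col (alpha d).
Proof. by case: Hcol => _ /(_ d); rewrite -val_eqE. Qed.

Lemma neq_col_sigma d : (col d : nat) != col (sigma d).
Proof. by rewrite -col_alpha neq_col_alpha. Qed.

Lemma sigma_neq d : sigma d != d.
Proof. by apply: contraNneq (neq_col_sigma d) => ->. Qed.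

(** The edge of [d] borders the faces of [d] and [sigma d], so its colour is that of the third face
    at the vertex. *)
Lemma ecolE d : ecol d = col (sigma (sigma d)).
Proof.
have := neq_col_sigma d; have := neq_col_sigma (sigma d); have := neq_col_sigma (sigma (sigma d)).
have := ltn_ord (col d); have := ltn_ord (col (sigma d)); have := ltn_ord (col (sigma (sigma d))).
rewrite /ecol col_alpha (sigma3 HG); lia.
Qed.

Lemma ecol_lt3 d : ecol d < 3. Proof. by rewrite ecolE. Qed.

Lemma ecol_alpha d : ecol (alpha d) = ecol d.
Proof. by rewrite /ecol (alphaK HG) subnAC. Qed.

Lemma edge_colE d : edge_col alpha col d = ecol d :> nat.
Proof. by rewrite /edge_col /third inordK // ecol_lt3. Qed.

Lemma neq_ecol x y : vert x = vert y -> x != y -> ecol x != ecol y.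
Proof.
have nc := neq_col_sigma.
move=> /(same_vertP HG)[] ->; rewrite ?eqxx // => _; rewrite !ecolE ?(sigma3 HG).
  by rewrite -{2}(sigma3 HG x) nc.
by rewrite eq_sym nc.
Qed.

Lemma col_alpha_phi d : col (alpha (phi d)) = ecol d :> nat.
Proof. by rewrite col_alpha -ecol_alpha ecolE. Qed.

(** With [col_alpha_phi]: each step around a face swaps the edge colour with the colour of the face
    across, so the edges of a face alternate between two colours. *)
Lemma ecol_phi d : ecol (phi d) = col (alpha d).
Proof.
have := neq_col_alpha d; have := ltn_ord (col d); have := ltn_ord (col (alpha d)).
rewrite [LHS]/ecol col_alpha_phi col_phi /ecol; lia.
Qed.

(** The cyclic order of the face colours around the vertex. It is constant on vertices and flips
    along edges, hence is a bipartition of the lattice. *)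
Definition chirality (d : D) : bool := (col (sigma d) : nat) == (col d).+1 %% 3.

Lemma chirality_alpha d : chirality (alpha d) = ~~ chirality d.
Proof.
rewrite /chirality -[sigma (alpha d)]/(phi d) col_phi -col_alpha.
have := neq_col_alpha d; have := ltn_ord (col d); have := ltn_ord (col (alpha d)); lia.
Qed.

Lemma chirality_sigma d : chirality (sigma d) = chirality d.
Proof.
have := neq_col_sigma d; have := neq_col_sigma (sigma d); have := neq_col_sigma (sigma (sigma d)).
have := ltn_ord (col d); have := ltn_ord (col (sigma d)); have := ltn_ord (col (sigma (sigma d))).
rewrite /chirality (sigma3 HG); lia.
Qed.

Lemma chirality_vert x y : vert x = vert y -> chirality y = chirality x.
Proof. by move=> /(same_vertP HG)[] ->; rewrite ?chirality_sigma. Qed.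

(** * Holonomy of closed walks in the reflection group *)

Section Holonomy.
Variable W : seq nat.
Hypothesis (HW : forall d, fweight alpha sigma d = nth 0 W (col d))
           (weights : forall d, fweight alpha sigma d \in [:: 4; 6; 8; 12]).

Definition trivial_holonomy (w : seq D) : Prop := forall v, act W (map ecol w) v = v.

Lemma holonomy_face d : trivial_holonomy (traject phi d (order phi d)).
Proof.
have even_wt : fweight alpha sigma d = (fweight alpha sigma d)./2.*2.
  by have := weights d; rewrite !inE => /or4P[] /eqP ->.
move=> v; rewrite -/(fweight alpha sigma d) even_wt.
(* A walk along a face reads two letters alternately, so [n.*2] darts give the [n]-th power of a
   product of two reflections. *)
have alt n x u : act W (map ecol (traject phi x n.*2)) u =
    iter n (fun u => reflection W (ecol (phi x)) (reflection W (ecol x) u)) u.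
  elim: n x u => // n IH x u; rewrite iterSr doubleS /= IH.
  have e : ecol (phi (phi x)) = ecol x by rewrite ecol_phi col_alpha_phi.
  by rewrite {1}e [ecol (phi (phi (phi x)))]ecol_phi -/(phi _) col_alpha_phi.
have third_col : col d = 3 - ecol d - ecol (phi d) :> nat.
  rewrite ecol_phi /ecol; have := neq_col_alpha d.
  by have := ltn_ord (col d); have := ltn_ord (col (alpha d)); lia.
rewrite alt HW third_col; apply: reflection_braid; rewrite ?ecol_lt3 //.
  rewrite -(ecol_alpha d) neq_ecol ?(vert_sigma HG) //.
  by apply: contraNneq (neq_col_alpha d) => ->; rewrite col_phi.
by rewrite -third_col -HW.
Qed.

(** A backtrack reads the same letter twice, a face boundary acts trivially, and a change of base
    point is a conjugation. *)
Lemma hom_step_holonomy s t : hom_step vert alpha sigma s t ->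
  trivial_holonomy s <-> trivial_holonomy t.
Proof.
case=> _ _ [[s1 [s2 [d [-> ->]]]]|[s1 [s2 [d [-> ->]]]]|->].
- split=> H v; have := H v; rewrite !map_cat !act_cat /= ecol_alpha reflectionK //.
- by split=> H v; have := H v; rewrite !map_cat !act_cat holonomy_face.
- by rewrite /trivial_holonomy map_rot; split=> /act_rot1.
Qed.

Lemma contractible_holonomy w : contractible vert alpha sigma w -> trivial_holonomy w.
Proof.
move=> H; suff: trivial_holonomy w <-> trivial_holonomy [::] by move=> ->.
elim: H => {w} [s t /hom_step_holonomy //|//|s t _ ->|s t u _ -> _ ->] //.
Qed.

(** Edges meeting at a vertex have distinct colours, so a repeated letter would be a backtrack along
    one edge. *)
Lemma cycle_ecol w : 1 < size w -> is_cycle vert alpha w ->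
  cycle (fun i j => i != j) (map ecol w).
Proof.
move=> sz /and4P[cw _ uv ue]; rewrite cycle_map.
apply: (cycle_from_next (map_uniq uv)) => x xw /=.
have nx := next_closed_walk cw xw.
rewrite -(ecol_alpha x) neq_ecol //; apply/eqP => e.
have : next w x = x.
  by apply: (uniq_map_inj_in ue); rewrite ?mem_next // -e (edge_alpha HG).
by move=> nxx; have := vert_alpha HG x; rewrite -nx nxx eqxx.
Qed.

Hypothesis Hlarge : forall w : seq D, is_cycle vert alpha w ->
  ~ contractible vert alpha sigma w -> 8 < size w.

(** By contraposition: a word that moves the test point shows its cycle to be non-contractible,
    hence longer than 8. *)
Lemma short_cycle_fixes w : 1 < size w <= 8 -> is_cycle vert alpha w ->
  ~~ moves W (map ecol w).
Proof.
move=> /andP[sz1 sz8] cw; apply/negP; rewrite /moves cycle_ecol //= => /eqP H.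
have: 8 < size w by apply: Hlarge => // /contractible_holonomy /(_ generic_point).
by rewrite ltnNge sz8.
Qed.

End Holonomy.
End Colouring.

(** * Weights and short cycles of the three lattices *)

Section Lattice.
Variables (k : lattice_kind) (D V : finType) (vert : D -> V) (alpha sigma : D -> D).
Variables (col : D -> 'I_3).
Hypotheses (HG : is_ccl_torus vert alpha sigma) (Hcol : face_colouring alpha sigma col).
Hypotheses (Hkind : has_config alpha sigma k).
Hypothesis Hlarge : forall w : seq D, is_cycle vert alpha w ->
  ~ contractible vert alpha sigma w -> 8 < size w.

Local Notation phi := (phi alpha sigma).
Local Notation ec := (ecol alpha col).
Local Notation wt := (fweight alpha sigma).

Lemma fweight_config d : wt d \in config k.
Proof. by rewrite -(perm_mem (Hkind d)) inE eqxx. Qed.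

Lemma fweight_values d : wt d \in [:: 4; 6; 8; 12].
Proof. by have := fweight_config d; case: k; rewrite !inE => /or3P[] /eqP ->. Qed.

(** The weights at the two ends of an edge have the same sum, and the two faces along the edge are
    shared. *)
Lemma fweight_third d : wt (sigma (sigma (alpha d))) = wt (sigma (sigma d)).
Proof.
have /perm_sumn /= := Hkind d; have /perm_sumn /= := Hkind (alpha d).
rewrite (fweight_alpha HG) -[sigma (alpha d)]/(phi d) (fweight_phi HG); lia.
Qed.

Lemma dart_ind (P : D -> Prop) (s : D) : P s ->
  (forall d, P d -> P (alpha d)) -> (forall d, P d -> P (sigma d)) -> forall d, P d.
Proof.
move=> Ps Pa Psig d; have [_ [_ [_ [_ [_ [_ [/(_ s d) /connectP[p pth ->] _]]]]]]] := HG.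
elim: p s Ps pth => //= y p IH s Ps /andP[/orP[]/eqP -> pth]; apply: IH pth; auto.
Qed.

Definition colour_weights (s : D) : seq nat :=
  mkseq (fun c => if c == col s then wt s else
                  if c == col (sigma s) then wt (sigma s) else wt (sigma (sigma s))) 3.

Lemma perm_colour_weights s : perm_eq (colour_weights s) (config k).
Proof.
rewrite -(permPr (Hkind s)) /colour_weights /mkseq /=.
have := neq_col_sigma HG Hcol s; have := neq_col_sigma HG Hcol (sigma s).
have := neq_col_sigma HG Hcol (sigma (sigma s)); rewrite (sigma3 HG).
have := ltn_ord (col s); have := ltn_ord (col (sigma s)); have := ltn_ord (col (sigma (sigma s))).
move: (nat_of_ord _) (nat_of_ord _) (nat_of_ord _).
case=> [|[|[|//]]] [|[|[|//]]] [|[|[|//]]] //= _ _ _ _ _ _;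
 by apply/permP => a /=; lia.
Qed.

(** Weight is a function of colour: the claim for the three faces at a vertex spreads by
    connectivity, [fweight_third] handling the face that changes across an edge. *)
Lemma fweight_col s d : wt d = nth 0 (colour_weights s) (col d).
Proof.
have wE x : nth 0 (colour_weights s) (col x) = if col x == col s then wt s else
    if col x == col (sigma s) then wt (sigma s) else wt (sigma (sigma s)).
  by rewrite /colour_weights nth_mkseq // -!val_eqE.
suff: [/\ wt d = nth 0 (colour_weights s) (col d),
          wt (sigma d) = nth 0 (colour_weights s) (col (sigma d)) &
          wt (sigma (sigma d)) = nth 0 (colour_weights s) (col (sigma (sigma d)))] by case.
move: d; apply: (dart_ind (s := s)) => [|d [h1 h2 h3]|d [h1 h2 h3]].
- have nc := neq_col_sigma HG Hcol; have nc3 := nc (sigma (sigma s)).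
  rewrite (sigma3 HG) in nc3.
  rewrite !wE !eqxx -!val_eqE /= (negbTE nc3) (eq_sym (nat_of_ord (col (sigma s)))) (negbTE (nc s)).
  by rewrite eq_sym (negbTE (nc _)).
- rewrite (fweight_alpha HG) (col_alpha HG Hcol) fweight_third -[sigma (alpha d)]/(phi d).
  rewrite (fweight_phi HG) (col_phi Hcol); split => //.
  rewrite h3; congr (nth _ _ _).
  by rewrite -[sigma (phi d)]/(sigma (sigma (alpha d))) -!(ecolE HG Hcol) (ecol_alpha _ HG).
- by rewrite (sigma3 HG).
Qed.

Lemma short_cycle_word s w : 1 < size w <= 8 -> is_cycle vert alpha w ->
  ~~ moves (colour_weights s) (map ec w).
Proof. exact: (short_cycle_fixes HG Hcol (fweight_col s) fweight_values Hlarge). Qed.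

Lemma all_ecol w : all (fun i => i < 3) (map ec w).
Proof. by apply/allP => _ /mapP[x _ ->]; exact: ecol_lt3 HG Hcol x. Qed.

(** Two parallel edges would form a cycle of length 2, excluded by [moves2]. *)
Lemma no_parallel_edges x y :
  vert x = vert y -> vert (alpha x) = vert (alpha y) -> x = y.
Proof.
move=> e e'; apply/eqP/negP => /negP neq.
have cyc : is_cycle vert alpha [:: x; alpha y].
  rewrite /is_cycle /closed_walk /= (alphaK HG) e e' !eqxx !inE !andbT /=.
  rewrite eq_sym (vert_alpha HG) (edge_alpha HG) /=.
  apply: contra neq => /eqP/edge_eqP[->//|ey].
  by have := vert_alpha HG x; rewrite -ey e eqxx.
have := @short_cycle_word x [:: x; alpha y] isT cyc.
by rewrite (moves2 (perm_colour_weights x) (all_ecol _)).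
Qed.

Lemma ends_eqP x y : [set vert x; vert (alpha x)] = [set vert y; vert (alpha y)] ->
  y = x \/ y = alpha x.
Proof.
move/setP => e; have := e (vert y); have := e (vert (alpha y)); have nl := vert_alpha HG.
rewrite !inE !eqxx orbT /= => /orP[]/eqP e1 /orP[]/eqP e2.
- by have := nl y; rewrite e1 e2 eqxx.
- by right; apply: no_parallel_edges; rewrite ?(alphaK HG).
- by left; apply: no_parallel_edges.
- by have := nl y; rewrite e1 e2 eqxx.
Qed.

Lemma no_4cycle s x y z : 4 < wt s -> 4 < wt (alpha s) ->
  ~~ is_cycle vert alpha [:: s; x; y; z].
Proof.
move=> ws was; apply/negP => /(@short_cycle_word s [:: s; x; y; z] isT).
rewrite (moves4 (perm_colour_weights s) (all_ecol _)) //=.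
(* A colour other than that of the edge [s] belongs to one of its two faces, whose weight exceeds 4
   and hence is at least 6. *)
have w1 c : c < 3 -> (c == ec s) || (5 < nth 0 (colour_weights s) c).
  move=> c3; have gt5 d : 4 < wt d -> 5 < wt d.
    by have := fweight_values d; rewrite !inE => /or4P[] /eqP ->.
  have := neq_col_alpha Hcol s; have := ltn_ord (col s); have := ltn_ord (col (alpha s)).
  move=> l1 l2 l3; have : [|| c == ec s, c == col s | c == col (alpha s)].
    by rewrite /ecol; lia.
  by case/or3P => /eqP ->; rewrite ?eqxx // -fweight_col gt5 ?orbT.
by rewrite !w1.
Qed.

Lemma no_6cycle s x1 x2 x3 x4 x5 : k = L488 ->
  ~~ is_cycle vert alpha [:: s; x1; x2; x3; x4; x5].
Proof.
move=> k8; have pW := perm_colour_weights s; rewrite k8 in pW.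
apply/negP => /(@short_cycle_word s [:: s; x1; x2; x3; x4; x5] isT).
by rewrite (moves6 pW (all_ecol _)).
Qed.

(** The two weights are the first two entries of a permutation of the configuration, so finitely
    many cases are checked. *)
Lemma fweight_minimal s : wt s <= wt (alpha s) ->
  wt s = match k with
         | Honeycomb => 6
         | L488 => if (wt s == 4) || (wt (alpha s) == 4) then 4 else 8
         | L4612 => if (wt s == 4) || (wt (alpha s) == 4) then 4 else 6
         end.
Proof.
rewrite (fweight_alpha HG); have := Hkind s; rewrite -mem_permutations.
pose P t := let a := nth 0 t 0 in let b := nth 0 t 1 in
  (a <= b) ==> (a == match k with
                     | Honeycomb => 6
                     | L488 => if (a == 4) || (b == 4) then 4 else 8
                     | L4612 => if (a == 4) || (b == 4) then 4 else 6
                     end).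
have /allP H : all P (permutations (config k)) by rewrite /P; case: k.
by move=> /H/implyP Hs /Hs/eqP.
Qed.

End Lattice.

(** * The edges removed by the procedure *)

Section RemovedEdges.
Variables (D V : finType) (vert : D -> V) (alpha sigma : D -> D) (col : D -> 'I_3).
Hypotheses (HG : is_ccl_torus vert alpha sigma) (Hcol : face_colouring alpha sigma col).
Hypothesis simpleG : forall x y,
  [set vert x; vert (alpha x)] = [set vert y; vert (alpha y)] -> y = x \/ y = alpha x.
Variable s : D.

Local Notation phi := (phi alpha sigma).
Local Notation faceD := (faceD alpha sigma).
Local Notation edge := (edge alpha).
Local Notation adj_out := (adj_out vert alpha sigma col s).
Local Notation S := (faceD s).
Local Notation B := (col (alpha s)).

(** The edges of [S] facing colour [B] across are those of the same colour as [e]. *)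
Definition removed_darts : {set D} := [set d in S | col (alpha d) == B].

Lemma col_S d : d \in S -> col d = col s.
Proof. by rewrite mem_face => /(col_face Hcol). Qed.

Lemma alpha_notin_S d : d \in S -> alpha d \notin S.
Proof. by move=> dS; apply: contraNN (neq_col_alpha Hcol d) => /col_S ->; rewrite col_S. Qed.

Lemma edge_col_B d : d \in S -> (edge_col alpha col d == B) = (d \notin removed_darts).
Proof.
move=> dS; rewrite inE dS -!val_eqE /= (edge_colE HG Hcol) /ecol (col_S dS).
have := neq_col_alpha Hcol s; have := neq_col_alpha Hcol d; rewrite (col_S dS).
have := ltn_ord (col s); have := ltn_ord (col (alpha s)); have := ltn_ord (col (alpha d)); lia.
Qed.

Lemma mem_face_edges d (F : {set D}) :
  (edge d \in face_edges alpha F) = (d \in F) || (alpha d \in F).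
Proof.
apply/imsetP/orP => [[x xF /edge_eqP[]]|[dF|dF]].
- by move=> <-; left.
- by move=> <-; right.
- by exists d.
- by exists (alpha d); rewrite ?(edge_alpha HG).
Qed.

Lemma removed_notin_Bedges d : d \in removed_darts -> edge d \notin Bedges alpha sigma col s.
Proof.
move=> dR; have dS : d \in S by move: dR; rewrite inE => /andP[].
apply/imsetP => -[y]; rewrite inE => /andP[yS]; rewrite edge_col_B //.
by move=> yR /edge_eqP[|] ey; [rewrite ey dR in yR | have := alpha_notin_S dS; rewrite -ey yS].
Qed.

(** As the lattice is simple, only the edge of [d] or a copy of it could join these ends. It has no
    copy, and the faces it borders, [S] and a merge face, are both deleted. *)
Lemma adj_out_removed d : d \in removed_darts -> ~~ adj_out [set vert d; vert (alpha d)].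
Proof.
move=> dR; have /andP[dS /eqP dB] : (d \in S) && (col (alpha d) == B) by rewrite inE in dR.
have dnB := removed_notin_Bedges dR.
apply/existsP => -[[E b] /andP[]]; rewrite inE => /andP[Einit /existsP[F /andP[Fnew EF]]].
have [x Ex] : exists x, E = edge x.
  by case/setUP: Einit => /imsetP[E' /imsetP[x _ ->] [-> _]]; exists x.
rewrite /ends Ex /= ends_edge => /eqP/esym/simpleG xd.
have {xd} Ed : E = edge d by case: xd Ex => ->; rewrite ?(edge_alpha HG).
move: Fnew EF {x Ex}; rewrite Ed => /setUP[/setUP[]|].
(* The new faces are of three kinds: surviving old faces, digons, and the merged face. *)
- case/imsetP=> F'; rewrite inE => /and3P[/imsetP[z _ Fz] FS Fm] ->.
  case/imsetP => E' E'F [E'd _]; rewrite -E'd in E'F.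
  rewrite mem_face_edges in E'F.
  case/orP: E'F => dF; rewrite Fz in dF FS Fm.
    by move: FS; rewrite /Sface -(face_eq HG dF) -(face_eq HG dS) eqxx.
  case/negP: Fm; rewrite inE imset_f //=; apply/andP; split.
    by apply/existsP; exists (alpha d); rewrite dF dB eqxx.
  apply/existsP; exists (edge d); rewrite !mem_face_edges.
  by rewrite dS dF orbT.
- by case/imsetP => f fB ->; rewrite !inE => /orP[]/eqP[ef _]; rewrite ef fB in dnB.
- rewrite inE => /eqP ->; rewrite inE => /orP[] /imsetP[f].
    by move=> fB [ef]; rewrite ef fB in dnB.
  by rewrite inE => /andP[_ /negP nfS] [ef _]; apply: nfS; rewrite -ef mem_face_edges dS.
Qed.

(** An edge of [S] of colour [B] survives through its copy in a digon. An edge off [S] has a side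
    whose colour is not [B], and that face is not deleted. *)
Lemma adj_out_kept d : d \notin removed_darts -> alpha d \notin removed_darts ->
  adj_out [set vert d; vert (alpha d)].
Proof.
have all_d x : edge x \in all_edges alpha by apply: imset_f.
have inS x : x \in S -> x \notin removed_darts -> adj_out [set vert x; vert (alpha x)].
  move=> xS xR.
  have xB : edge x \in Bedges alpha sigma col s.
    by apply: imset_f; rewrite inE xS edge_col_B.
  apply/existsP; exists (edge x, true); rewrite /ends ends_edge eqxx andbT inE; apply/andP; split.
    by apply/setUP; right; apply: imset_f.
  apply/existsP; exists [set (edge x, false); (edge x, true)]; rewrite !inE eqxx orbT andbT.
  by rewrite (imset_f (fun f => [set (f, false); (f, true)]) xB) orbT.
have ninS x : x \notin S -> col x != B -> adj_out [set vert x; vert (alpha x)].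
  move=> xS xB; apply/existsP; exists (edge x, false); rewrite /ends ends_edge eqxx andbT inE.
  apply/andP; split; first by apply/setUP; left; apply: imset_f.
  apply/existsP; exists [set (E, false) | E in face_edges alpha (faceD x)]; apply/andP; split.
    apply/setUP; left; apply/setUP; left; apply: imset_f; rewrite inE imset_f //=.
    apply/andP; split.
      by apply: contraNneq xS; rewrite /Sface => <-; rewrite mem_face connect0.
    rewrite inE imset_f //=; apply: contraNN xB => /andP[/existsP[y /andP[yx yB]] _].
    by rewrite mem_face in yx; rewrite -(col_face Hcol yx).
  by apply: imset_f; apply: imset_f; rewrite mem_face connect0.
have swap x : [set vert (alpha x); vert (alpha (alpha x))] = [set vert x; vert (alpha x)].
  by rewrite (alphaK HG) setUC.
move=> dR adR; have [dS|dS] := boolP (d \in S); first exact: inS.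
have [adS|adS] := boolP (alpha d \in S); first by rewrite -swap; apply: inS.
have [dB|dB] := eqVneq (col d) B; last exact: ninS.
rewrite -swap; apply: ninS => //; rewrite -dB -val_eqE eq_sym; exact: neq_col_alpha Hcol d.
Qed.

Lemma s_removed : s \in removed_darts.
Proof. by rewrite inE mem_face connect0 eqxx. Qed.

(** [phi] exchanges the removed and the kept darts of [S]. *)
Lemma card_removed : #|removed_darts|.*2 = fweight alpha sigma s.
Proof.
have phiS d : (phi d \in S) = (d \in S).
  by rewrite !mem_face -same_fconnect1_r //; exact: phi_inj HG.
have phiR d : d \in S -> (phi d \in removed_darts) = (d \notin removed_darts).
  move=> dS; rewrite [in LHS]inE phiS dS -val_eqE /= (col_alpha_phi HG Hcol) -edge_col_B //.
  by rewrite -val_eqE /= (edge_colE HG Hcol).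
have -> : fweight alpha sigma s = #|S| by apply: eq_card => x; rewrite mem_face.
rewrite -(cardsID removed_darts S) -addnn.
have -> : S :&: removed_darts = removed_darts.
  by apply/setIidPr/subsetP => x; rewrite inE => /andP[].
congr (_ + _); rewrite -(card_imset _ (phi_inj HG)); apply: eq_card => x.
rewrite inE; apply/imsetP/andP => [[d dR ->]|[xR xS]].
  have dS : d \in S by move: dR; rewrite inE => /andP[].
  by rewrite phiS dS phiR // dR.
have [y xy] : exists y, x = phi y.
  by exists (finv phi x); rewrite f_finv //; exact: phi_inj HG.
exists y => //; move: xR; rewrite xy phiR ?negbK // -phiS -xy //.
Qed.

(** Distinct removed darts give distinct pairs, because [S] never contains both darts of an edge;
    [s] itself is discounted. *)
Lemma Rcount_adj_out :
  Rcount (adjacent vert alpha) adj_out (vert s) (vert (alpha s)) =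
  (fweight alpha sigma s - 2) %/ 2.
Proof.
pose pr d := [set vert d; vert (alpha d)].
have pr_inj : {in removed_darts :\ s &, injective pr}.
  move=> x y /setD1P[_ xR] /setD1P[_ yR] /simpleG[//|e].
  move: xR yR; rewrite e ![_ \in removed_darts]inE => /andP[xS _] /andP[axS _].
  by have := alpha_notin_S xS; rewrite axS.
have -> : Rcount (adjacent vert alpha) adj_out (vert s) (vert (alpha s)) =
  #|pr @: (removed_darts :\ s)|.
  apply: eq_card => p; rewrite inE.
  apply/and4P/imsetP => [[_ ps /existsP[d /eqP pd] np]|[d /setD1P[ds dR] ->]].
    have : (d \in removed_darts) || (alpha d \in removed_darts).
      rewrite -[_ || _]negbK negb_or; apply: contraNN np => /andP[dR adR].
      by rewrite -pd adj_out_kept.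
    case/orP => dR.
      exists d => //; rewrite in_setD1 dR andbT; apply: contraNneq ps => <-; by rewrite pd.
    exists (alpha d); last by rewrite /pr (alphaK HG) setUC pd.
    rewrite in_setD1 dR andbT; apply: contraNneq ps => <-.
    by rewrite -pd (alphaK HG) setUC.
  split.
  - by rewrite cards2 [vert d == _]eq_sym (vert_alpha HG).
  - apply: contraNneq ds => e.
    case: (simpleG e) => e'; first by rewrite e'.
    move: dR; rewrite inE => /andP[/alpha_notin_S + _].
    by rewrite -e' mem_face connect0.
  - by apply/existsP; exists d.
  - exact: adj_out_removed.
rewrite card_in_imset // -card_removed (cardsD1 s removed_darts) s_removed; lia.
Qed.

End RemovedEdges.

(** * Edges of multiplicity zero *)

Section Alternating.
Variables (D V : finType) (vert : D -> V) (alpha sigma : D -> D) (col : D -> 'I_3).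
Hypotheses (HG : is_ccl_torus vert alpha sigma) (Hcol : face_colouring alpha sigma col).
Hypothesis no_parallel : forall x y,
  vert x = vert y -> vert (alpha x) = vert (alpha y) -> x = y.
(* [m d] stands for the number of edges of [H] over the edge of [d]. *)
Variable m : D -> nat.
Hypotheses (m_alpha : forall d, m (alpha d) = m d)
           (m_star : forall d, m d + m (sigma d) + m (sigma (sigma d)) = 3).

Local Notation chir := (chirality sigma col).

Definition alternates (d f d' : D) : Prop :=
  [/\ vert f = vert (alpha d), 1 < m f, vert d' = vert (alpha f) & m d' = 0].

(** Beyond a zero edge two multiplicities sum to 3, so one is at least 2; at its other end the
    remaining two sum to at most 1, so one is 0. *)
Lemma alternates_exists d : m d = 0 -> exists f d', alternates d f d'.
Proof.
move=> md; have [f [vf mf]] : exists f, vert f = vert (alpha d) /\ 1 < m f.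
  have := m_star (alpha d); rewrite m_alpha md => e.
  have [h|h] := ltnP 1 (m (sigma (alpha d))).
    by exists (sigma (alpha d)); rewrite (vert_sigma HG).
  by exists (sigma (sigma (alpha d))); rewrite !(vert_sigma HG); split=> //; lia.
have := m_star (alpha f); rewrite m_alpha => e.
have [h|h] := posnP (m (sigma (alpha f))).
  by exists f, (sigma (alpha f)); rewrite /alternates (vert_sigma HG).
exists f, (sigma (sigma (alpha f))); rewrite /alternates !(vert_sigma HG); split=> //; lia.
Qed.

Lemma multiple_edge_unique f g : vert f = vert g -> 1 < m f -> 1 < m g -> f = g.
Proof. by move=> /(same_vertP HG)[] -> //; have := m_star f; lia. Qed.

Lemma vert_neq x y : chir x != chir y -> vert x != vert y.
Proof. by apply: contraNneq => /(chirality_vert HG Hcol) ->. Qed.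

Lemma alternates_chir d f d' : alternates d f d' ->
  chir f = ~~ chir d /\ chir d' = chir d.
Proof.
case=> vf _ vd' _; rewrite -(chirality_vert HG Hcol vd') (chirality_alpha HG Hcol).
by rewrite -(chirality_vert HG Hcol vf) (chirality_alpha HG Hcol) negbK.
Qed.

(** Otherwise [f] would be parallel to [d], hence the same edge, with multiplicity both 0 and at
    least 2. *)
Lemma alternates_vert d f d' : m d = 0 -> alternates d f d' -> vert d' != vert d.
Proof.
move=> md [vf mf vd' _]; apply/eqP => e.
have fd : f = alpha d by apply: no_parallel; rewrite ?(alphaK HG) // -vd'.
by move: mf; rewrite fd m_alpha md.
Qed.

Lemma alternates_neq d f d' : m d = 0 -> alternates d f d' -> d' != d.
Proof. by move=> md /(alternates_vert md); apply: contraNneq => ->. Qed.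

Variable s : D.
Hypothesis m_s : m s = 0.

(** Chirality separates the starts of zero darts from those of multiple darts. Two multiple darts
    starting at one vertex coincide, and then so would the starts of the zero darts following
    them. *)
Lemma alternates_4cycle f1 d1 f2 : alternates s f1 d1 -> alternates d1 f2 s ->
  is_cycle vert alpha [:: s; f1; d1; f2].
Proof.
move=> a1 a2; have [cf1 cd1] := alternates_chir a1; have [cf2 _] := alternates_chir a2.
have n1 := alternates_vert m_s a1; case: (a1) (a2) => vf1 mf1 vd1 md1 [vf2 mf2 vs _].
apply: (is_cycle_uniq_vert HG) => //; first by rewrite /closed_walk /= vf1 vd1 vf2 vs !eqxx.
rewrite /= !inE !negb_or !andbT; apply/and3P; split.
- apply/and3P; split; rewrite 1?[vert s == _]eq_sym // vert_neq // ?cf2 ?cf1 ?cd1;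
    by case: (chir s).
- apply/andP; split; first by rewrite vert_neq // cf1 cd1; case: (chir s).
  apply: contraNneq n1 => /multiple_edge_unique e.
  by rewrite vd1 (e mf1 mf2) -vs.
- by rewrite vert_neq // cf2; case: (chir d1).
Qed.

Lemma alternates_6cycle f1 d1 f2 d2 f3 :
  alternates s f1 d1 -> alternates d1 f2 d2 -> alternates d2 f3 s ->
  is_cycle vert alpha [:: s; f1; d1; f2; d2; f3].
Proof.
move=> a1 a2 a3.
have [cf1 cd1] := alternates_chir a1; have [cf2 cd2] := alternates_chir a2.
have [cf3 _] := alternates_chir a3.
case: (a1) (a2) (a3) => vf1 mf1 vd1 md1 [vf2 mf2 vd2 md2] [vf3 mf3 vs _].
have n1 := alternates_vert m_s a1; have n2 := alternates_vert md1 a2.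
have n3 := alternates_vert md2 a3.
have nf x y : 1 < m x -> 1 < m y -> vert (alpha x) != vert (alpha y) -> vert x != vert y.
  by move=> mx my; apply: contraNneq => /multiple_edge_unique -> //.
have nx x y : chir x = ~~ chir y -> (vert x == vert y) = false.
  by move=> e; apply/negbTE/vert_neq; rewrite e; case: (chir y).
apply: (is_cycle_uniq_vert HG) => //.
  by rewrite /closed_walk /= vf1 vd1 vf2 vd2 vf3 vs !eqxx.
have nx' x y : chir x = ~~ chir y -> (vert y == vert x) = false.
  by move=> /nx; rewrite eq_sym.
have c1 : chir f1 = ~~ chir s by [].
rewrite /= !inE !negb_or (nx' f1 s) // (nx' f2 s) ?cf2 ?cd1 // (nx' f3 s) ?cf3 ?cd2 ?cd1 //.
rewrite (nx f1 d1) ?cd1 // (nx f1 d2) ?cd2 ?cd1 // (nx' f2 d1) // (nx' f3 d1) ?cf3 ?cd2 //.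
rewrite (nx f2 d2) ?cd2 // (nx' f3 d2) //= !andbT.
rewrite 1?[vert s == vert d1]eq_sym n1 n3 [vert d1 == _]eq_sym n2 /=.
have n12 : vert f1 != vert f2 by apply: nf; rewrite // -vd1 -vd2 eq_sym.
have n13 : vert f1 != vert f3 by apply: nf; rewrite // -vd1 -vs.
have n23 : vert f2 != vert f3 by apply: nf; rewrite // -vd2 -vs eq_sym.
by rewrite n12 n13 n23.
Qed.

(** Fixing the chirality selects one dart of each edge, so the cardinal counts edges; alternation
    stays in this set. *)
Definition zero_darts : {set D} := [set d | (m d == 0) && (chir d == chir s)].

Lemma mem_zero_darts d f d' : d \in zero_darts -> alternates d f d' -> d' \in zero_darts.
Proof.
rewrite !inE => /andP[_ /eqP <-] a; have [_ ->] := alternates_chir a.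
by case: a => _ _ _ ->; rewrite !eqxx.
Qed.

Lemma zero_darts_s : s \in zero_darts. Proof. by rewrite inE m_s !eqxx. Qed.

Lemma leq_zero_darts (l : seq D) : uniq l -> {subset l <= zero_darts} -> size l <= #|zero_darts|.
Proof. by move=> /card_uniqP <- H; apply/subset_leq_card/subsetP. Qed.

Lemma two_zero_darts : 2 <= #|zero_darts|.
Proof.
have [f1 [d1 a1]] := alternates_exists m_s.
apply: (@leq_zero_darts [:: s; d1]).
  by rewrite /= inE eq_sym (alternates_neq m_s a1).
by apply/allP; rewrite /= zero_darts_s (mem_zero_darts zero_darts_s a1).
Qed.

Hypothesis no4 : forall x y z, ~~ is_cycle vert alpha [:: s; x; y; z].

Lemma alternates2_neq f1 d1 f2 d2 : alternates s f1 d1 -> alternates d1 f2 d2 ->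
  uniq [:: s; d1; d2].
Proof.
move=> a1 a2; have md1 : m d1 = 0 by case: a1.
rewrite /= !inE !negb_or !andbT (eq_sym s) (alternates_neq m_s a1).
rewrite (eq_sym d1) (alternates_neq md1 a2) andbT; apply/eqP => e.
by move: a2; rewrite -e => /(alternates_4cycle a1); apply/negP.
Qed.

Lemma three_zero_darts : 3 <= #|zero_darts|.
Proof.
have [f1 [d1 a1]] := alternates_exists m_s.
have [f2 [d2 a2]] : exists f d, alternates d1 f d by apply: alternates_exists; case: a1.
have z1 := mem_zero_darts zero_darts_s a1.
apply: (leq_zero_darts (alternates2_neq a1 a2)).
by apply/allP; rewrite /= zero_darts_s z1 (mem_zero_darts z1 a2).
Qed.

Hypothesis no6 : forall x1 x2 x3 x4 x5, ~~ is_cycle vert alpha [:: s; x1; x2; x3; x4; x5].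

(** The third step cannot return to [s], which would close a 6-cycle, nor stay at [d2]; if it falls
    back on [d1], a fourth zero dart is found at the vertex of [d1]. *)
Lemma four_zero_darts : 4 <= #|zero_darts|.
Proof.
have [f1 [d1 a1]] := alternates_exists m_s; have md1 : m d1 = 0 by case: a1.
have [f2 [d2 a2]] := alternates_exists md1; have md2 : m d2 = 0 by case: a2.
have [f3 [d3 a3]] := alternates_exists md2.
have z1 := mem_zero_darts zero_darts_s a1; have z2 := mem_zero_darts z1 a2.
have z3 := mem_zero_darts z2 a3; have u := alternates2_neq a1 a2.
suff [d z n] : exists2 d, d \in zero_darts & d \notin [:: s; d1; d2].
  apply: (@leq_zero_darts [:: d; s; d1; d2]); first by rewrite /= n.
  by apply/allP; rewrite /= z zero_darts_s z1 z2.
have n32 := alternates_neq md2 a3.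
have n3s : d3 != s.
  by apply/eqP => e; move: a3; rewrite e => /(alternates_6cycle a1 a2); apply/negP.
have [e31|n31] := eqVneq d3 d1; last first.
  by exists d3; rewrite // !inE (negbTE n3s) (negbTE n31) (negbTE n32).
(* [f1] and [f3] are then the same edge, of multiplicity 3, so a second zero dart leaves [d1] *)
case: (a1) (a2) (a3) => vf1 mf1 vd1 _ [vf2 mf2 vd2 _] [vf3 mf3 vd3 _].
have f31 : alpha f3 = alpha f1.
  by apply: multiple_edge_unique; rewrite ?m_alpha // -vd3 -vd1 e31.
have {f31} f31 : f3 = f1 by apply: (inv_inj (alphaK HG)).
have mf1_3 : m f1 = 3.
  (* The darts [alpha s] and [alpha d2] are two distinct zero darts at the start of [f1], which
     leaves all 3 to [f1]. *)
  have ns2 : alpha s != alpha d2.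
    rewrite (inj_eq (inv_inj (alphaK HG))).
    by move: u; rewrite /= !inE negb_or; case/andP => /andP[].
  have := m_star f1; have ms := m_alpha s; have md := m_alpha d2.
  have := same_vertP HG vf1; have : vert f1 = vert (alpha d2) by rewrite -f31.
  move=> /(same_vertP HG)[] e2 [] e1; move: ns2 ms md; rewrite e1 e2 ?eqxx // m_s md2;
    by move: mf1; lia.
have [d [vd md nd]] : exists d, [/\ vert d = vert d1, m d = 0 & d != d1].
  have md : m (alpha f1) = 3 by rewrite m_alpha.
  have : alpha f1 != d1 by apply/eqP => e; move: md; rewrite e md1.
  have := m_star (alpha f1); rewrite md.
  case: (same_vertP HG (esym vd1)) => ->; rewrite ?eqxx // => ? _.
    exists (sigma (sigma (alpha f1))); rewrite !(vert_sigma HG); split; [by []|lia|].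
    by rewrite (sigma_neq HG Hcol).
  exists (sigma (alpha f1)); rewrite !(vert_sigma HG); split; [by []|lia|].
  by rewrite eq_sym (sigma_neq HG Hcol).
exists d.
  by rewrite inE md /= -(alternates_chir a1).2 (chirality_vert HG Hcol vd).
(* The new dart starts where [d1] does, a vertex different from the starts of [s] and of [d2]. *)
rewrite !inE !negb_or nd /=; apply/andP; split.
  by apply: contraNneq (alternates_vert m_s a1) => <-; rewrite vd.
by apply: contraNneq (alternates_vert md1 a2) => <-; rewrite vd.
Qed.

End Alternating.

(** * Multiplicities of a competing lattice over the given one *)

Section Subgraph.
Variables (D V : finType) (vert : D -> V) (alpha sigma : D -> D) (col : D -> 'I_3).
Hypotheses (HG : is_ccl_torus vert alpha sigma) (Hcol : face_colouring alpha sigma col).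
Hypothesis no_parallel : forall x y,
  vert x = vert y -> vert (alpha x) = vert (alpha y) -> x = y.
Hypothesis simpleG : forall x y,
  [set vert x; vert (alpha x)] = [set vert y; vert (alpha y)] -> y = x \/ y = alpha x.
Variable s : D.
Variables (DH : finType) (vertH : DH -> V) (alphaH sigmaH : DH -> DH).
Hypotheses (HH : is_ccl_torus vertH alphaH sigmaH)
  (subH : forall dh : DH, exists d : D,
     [/\ edge alpha d != edge alpha s, vert d = vertH dh & vert (alpha d) = vertH (alphaH dh)]).

(** Only darts oriented like [d] are taken, so each edge of [H] over the edge of [d] counts once. *)
Definition over (d : D) : {set DH} :=
  [set dh | (vertH dh == vert d) && (vertH (alphaH dh) == vert (alpha d))].

Definition mult (d : D) : nat := #|over d|.

Lemma mult_alpha d : mult (alpha d) = mult d.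
Proof.
rewrite /mult -(card_imset _ (inv_inj (alphaK HH))); apply: eq_card => x.
rewrite (can2_imset_pre _ (alphaK HH) (alphaK HH)) !inE.
by rewrite (alphaK HH) (alphaK HG) andbC.
Qed.

Lemma mult_s : mult s = 0.
Proof.
apply/eqP; rewrite cards_eq0; apply/eqP/setP => x; rewrite !inE.
apply/negP => /andP[/eqP e1 /eqP e2].
have [d [nd e3 e4]] := subH x; case/eqP: nd; congr (edge _ _).
by apply: no_parallel; congruence.
Qed.

(** Each of the three darts of [H] at the vertex lies over exactly one of the three darts of [G]
    there, as these have distinct far ends. *)
Lemma mult_star d : mult d + mult (sigma d) + mult (sigma (sigma d)) = 3.
Proof.
have mE x : vert x = vert d ->
    mult x = \sum_(y in [set y | vertH y == vert d]) (vertH (alphaH y) == vert (alpha x)).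
  move=> vx; rewrite /mult /over -sum1_card big_mkcond /= [RHS]big_mkcond /=.
  by apply: eq_bigr => y _; rewrite !inE vx; case: eqP => //= _; case: eqP.
rewrite !mE ?(vert_sigma HG) // -!big_split /= -(card_star HH (vert d)) -sum1_card.
apply: eq_bigr => y; rewrite inE => /eqP vy.
have [x [_ vx vax]] := subH y; rewrite -vax.
have neq a b : vert a = vert b -> a != b -> (vert (alpha a) == vert (alpha b)) = false.
  by move=> e; apply: contraNF => /eqP /(no_parallel e) ->.
have ns z : z != sigma z by rewrite eq_sym (sigma_neq HG Hcol).
have ns2 z : z != sigma (sigma z).
  by rewrite -{1}(sigma3 HG z) eq_sym ns.
have vs := vert_sigma HG.
have: vert d = vert x by rewrite vx vy.
by case/(same_vertP HG) => ->; rewrite eqxx !neq ?vs //; rewrite eq_sym.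
Qed.

(** Each zero dart is a removed pair, and distinct ones of equal chirality give distinct pairs; the
    successor accounts for [s]. *)
Lemma Rcount_ge : #|zero_darts sigma col mult s| <=
  (Rcount (adjacent vert alpha) (adjacent vertH alphaH) (vert s) (vert (alpha s))).+1.
Proof.
set Z := zero_darts _ _ _ _; pose pr d := [set vert d; vert (alpha d)].
have pr_inj : {in Z &, injective pr}.
  move=> x y; rewrite !inE => /andP[_ /eqP cx] /andP[_ /eqP cy] /simpleG[//|e].
  by move: cy; rewrite e (chirality_alpha HG Hcol) cx; case: (chirality _ _ s).
rewrite (cardsD1 s Z) (zero_darts_s _ _ mult_s) add1n ltnS.
have inj' : {in Z :\ s &, injective pr}.
  by move=> x y /setD1P[_ xZ] /setD1P[_ yZ]; apply: pr_inj.
rewrite -(card_in_imset inj') subset_leq_card //; apply/subsetP => _ /imsetP[d /setD1P[ds dZ] ->].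
rewrite inE; apply/and4P; split.
- by rewrite cards2 [vert d == _]eq_sym (vert_alpha HG).
- by apply: contraNneq ds => /pr_inj -> //; apply: zero_darts_s mult_s.
- by apply/existsP; exists d.
apply/existsP => -[x /eqP /setP e].
have : over d == set0.
  by move: dZ; rewrite inE => /andP[]; rewrite /mult cards_eq0.
(* An edge of [H] with these ends has a dart over [d] in one of its two orientations; the other
   matchings of ends would be loops. *)
apply/negP/set0Pn; have := vert_alpha HH x.
have := e (vertH x); have := e (vertH (alphaH x)); rewrite !inE !eqxx orbT /=.
move=> /esym/orP[]/eqP e1 /esym/orP[]/eqP e2; rewrite ?e1 ?e2 ?eqxx // => _.
  by exists (alphaH x); rewrite inE (alphaK HH) e1 e2 !eqxx.
by exists x; rewrite inE e1 e2 !eqxx.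
Qed.

End Subgraph.

Theorem theorem4 (k : lattice_kind) (D V : finType) (vert : D -> V)
    (alpha sigma : D -> D) (col : D -> 'I_3)
    (HG : is_ccl_torus vert alpha sigma)
    (Hcol : face_colouring alpha sigma col)
    (Hkind : has_config alpha sigma k)
    (Hlarge : forall w : seq D, is_cycle vert alpha w ->
              ~ contractible vert alpha sigma w -> 8 < size w)
    (s : D)
    (Hmin : fweight alpha sigma s <= fweight alpha sigma (alpha s)) :
  let K := fweight alpha sigma s in
  let v1 := vert s in
  let v2 := vert (alpha s) in
  let square := (fweight alpha sigma s == 4) || (fweight alpha sigma (alpha s) == 4) in
  let R' := Rcount (adjacent vert alpha) (adj_out vert alpha sigma col s) v1 v2 in
  [/\ R' = (K - 2) %/ 2,
      R' = match k with
           | Honeycomb => 2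
           | L488 => if square then 1 else 3
           | L4612 => if square then 1 else 2
           end
    & forall (DH : finType) (vertH : DH -> V) (alphaH sigmaH : DH -> DH),
        is_ccl_torus vertH alphaH sigmaH ->
        (forall dh : DH, exists d : D,
            [/\ edge alpha d != edge alpha s, vert d = vertH dh
              & vert (alpha d) = vertH (alphaH dh)]) ->
        R' <= Rcount (adjacent vert alpha) (adjacent vertH alphaH) v1 v2].

Proof.
move=> K v1 v2 square R'.
have simpleG := no_parallel_edges HG Hcol Hkind Hlarge.
have endsG := ends_eqP HG Hcol Hkind Hlarge.
have R'E : R' = (K - 2) %/ 2 := Rcount_adj_out HG Hcol endsG s.
have KE := fweight_minimal HG Hkind Hmin.
split; rewrite {}R'E //.
  by rewrite /K KE /square; case: (k) => //; case: ifP.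
move=> DH vertH alphaH sigmaH HH subH.
(* It remains to find [K / 2] zero darts: 2, 3 or 4 of them for [K] equal to 4, 6 or 8. *)
rewrite -ltnS; apply: leq_trans (Rcount_ge HG Hcol simpleG endsG HH subH).
have mA := mult_alpha HG HH; have m0 := mult_s simpleG subH.
have mS := mult_star HG Hcol simpleG HH subH.
have two := two_zero_darts HG Hcol simpleG mA mS m0.
have three : 4 < K -> 3 <= #|zero_darts sigma col (mult vert alpha vertH alphaH) s|.
  move=> K4; apply: (three_zero_darts HG Hcol simpleG mA mS m0) => x y z.
  (* By minimality of [S], the other face at the edge also has weight above 4. *)
  by apply: (no_4cycle HG Hcol Hkind Hlarge) => //; apply: leq_trans Hmin.
have four : 4 < K -> k = L488 -> 4 <= #|zero_darts sigma col (mult vert alpha vertH alphaH) s|.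
  move=> K4 k8; apply: (four_zero_darts HG Hcol simpleG mA mS m0) => *.
    by apply: (no_4cycle HG Hcol Hkind Hlarge) => //; apply: leq_trans Hmin.
  exact: (no_6cycle HG Hcol Hkind Hlarge).
move: two three four KE; rewrite -/K; case: (k) => two three four.
- by move=> KE; rewrite KE in three *; apply: three.
- by case: ifP => _ KE; rewrite KE in four *; [exact: two | exact: four].
- by case: ifP => _ KE; rewrite KE in three *; [exact: two | exact: three].
Qed.
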